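(* An algebra $(A,\sqcup,\underline{\phantom{a}}[\underline{\phantom{a}}])$ with two binary operations is isomorphic to an algebra of partial functions under override and update (i.e., belongs to $\operatorname{Rep}(\{\sqcup,\underline{\phantom{a}}[\underline{\phantom{a}}]\})$) if and only if it satisfies the following equations: $x\sqcup(y\sqcup z)=(x\sqcup y)\sqcup z$; $x\sqcup x=x$; (1) $x=x[x\sqcup y]$; (2) $x\sqcup y=y[x]\sqcup x$; (3) $x[y][z]=x[z\sqcup y]$; (4) $(x\sqcup y)[z]=x[z]\sqcup y[z]$; (5) $x[y[x[z]]]=x[y[x][z]]$; (6) $w[x[y[w[z]]]]=w[x[y[w][z]]]$.
   Context: Convention: $u[v][w]$ means $(u[v])[w]$. $\mathcal{P}(X,Y)$ is the set of partial functions from nonempty $X$ to nonempty $Y$. Override: $(f\sqcup g)(x)=f(x)$ if $x\in\mathrm{dom}(f)$, $=g(x)$ if $x\in\mathrm{dom}(g)\setminus\mathrm{dom}(f)$, undefined otherwise. Update: $f[g]$ is the restriction of $g\sqcup f$ to $\mathrm{dom}(f)$. $\operatorname{Rep}(\{\sqcup,\underline{\phantom{a}}[\underline{\phantom{a}}]\})$ is the class of algebras isomorphic to subsets of some $\mathcal{P}(X,Y)$ closed under $\sqcup$ and update, with these operations. *)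

(* Defs.v *)
From mathcomp Require Import all_boot.
From mathcomp Require Import boolp classical_sets functions.

Set Implicit Arguments.
Unset Strict Implicit.
Unset Printing Implicit Defensive.

Local Open Scope classical_set_scope.

Record ouAlgebra := OuAlgebra {
  ou_sort :> Type;
  ou_override : ou_sort -> ou_sort -> ou_sort;
  ou_update : ou_sort -> ou_sort -> ou_sort }.

Declare Scope ou_scope.
Delimit Scope ou_scope with ou.

Notation "x ⊔ y" := (ou_override x y)
  (at level 50, left associativity) : ou_scope.
(* The update [x[y]]; left associative, so that [x.[y].[z]] is [(x.[y]).[z]]. *)
Notation "x .[ y ]" := (ou_update x y) : ou_scope.

(* [f x = None] means that [x] lies outside the domain of [f]. *)
Definition pfun (X Y : Type) : Type := X -> option Y.

Section PartialFunctions.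
Variables X Y : Type.
Implicit Types (f g : pfun X Y) (D : set X).

Definition pdom f : set X := [set x | exists y, f x = Some y].

Definition prestrict f D : pfun X Y := fun x => if `[< D x >] then f x else None.

Definition poverride f g : pfun X Y :=
  fun x => if f x is Some y then Some y else g x.

Definition pupdate f g : pfun X Y := prestrict (poverride g f) (pdom f).

End PartialFunctions.

Definition pfun_ou (X Y : Type) : ouAlgebra :=
  OuAlgebra (@poverride X Y) (@pupdate X Y).

Definition ou_closed (B : ouAlgebra) (S : set B) : Prop :=
  forall x y, S x -> S y -> S (x ⊔ y)%ou /\ S (x.[y])%ou.

Definition ou_morphism (A B : ouAlgebra) (h : A -> B) : Prop :=
  {morph h : x y / (x ⊔ y)%ou} /\ {morph h : x y / (x.[y])%ou}.

Definition ou_Rep (A : ouAlgebra) : Prop :=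
  exists (X Y : Type) (S : set (pfun_ou X Y)) (h : A -> pfun_ou X Y),
    [/\ inhabited X, inhabited Y, ou_closed S,
        set_bij [set: A] S h & ou_morphism h].

(* Main.v *)
(* Soundness is checked pointwise. For the converse, the points of the
   representation are the homomorphisms from [A] to flat algebras [option Y],
   and it suffices to separate any [a <> b] by a point. If the domains of [a]
   and [b] differ, a set of elements closed under join and below the domain of
   one of them does it. Otherwise take a congruence [R] maximal among those not
   relating [a] and [b]. For each [x], "[R] outside of [dom x]" is a congruence
   containing [R], so either it is [R], or it relates [a] and [b]. In the first
   case [x] is undefined at the point; in the second case ([x] is large) its
   value is the class of [x] modulo agreement on the intersection of finitely
   many large domains. Since [a] and [b] agree, modulo [R], outside of every
   large domain, agreeing on such an intersection would force [R a b]. *)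

Require Import Defs.
From mathcomp Require Import all_boot.
From mathcomp Require Import boolp classical_sets functions.

Set Implicit Arguments.
Unset Strict Implicit.
Unset Printing Implicit Defensive.

Local Open Scope ou_scope.

Lemma pupdateE (X Y : Type) (f g : pfun X Y) p :
  pupdate f g p =
    if f p is Some y then Some (if g p is Some z then z else y) else None.
Proof.
rewrite /pupdate /prestrict /poverride.
case: asboolP => [[y ->]|]; first by case: (g p).
by rewrite /pdom /=; case: (f p) => // y []; exists y.
Qed.

(** * Identities derived from the equations, and equality of domains *)

Section Theory.
Context {A : ouAlgebra}.
Implicit Types (a b c d i u v w x y z : A) (f g : A -> A) (R : A -> A -> Prop).

Hypothesis ovrA : forall x y z, x ⊔ (y ⊔ z) = (x ⊔ y) ⊔ z.
Hypothesis ovrxx : forall x, x ⊔ x = x.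
Hypothesis upd_ovr : forall x y, x = x.[x ⊔ y].
Hypothesis ovr_upd : forall x y, x ⊔ y = y.[x] ⊔ x.
Hypothesis updA : forall x y z, x.[y].[z] = x.[z ⊔ y].
Hypothesis updDl : forall x y z, (x ⊔ y).[z] = x.[z] ⊔ y.[z].
Hypothesis upd5 : forall x y z, x.[y.[x.[z]]] = x.[y.[x].[z]].
Hypothesis upd6 : forall w x y z, w.[x.[y.[w.[z]]]] = w.[x.[y.[w].[z]]].

Lemma updxx x : x.[x] = x.
Proof. by rewrite {3}(upd_ovr x x) ovrxx. Qed.

Lemma ovrK x y : x ⊔ y ⊔ x = x ⊔ y.
Proof. by rewrite (ovr_upd x y) -ovrA ovrxx. Qed.

Lemma updK x y : x.[x.[y]] = x.[y].
Proof.
have e : x = x.[y].[x] by rewrite updA -upd_ovr.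
by rewrite {1}e updA -upd_ovr.
Qed.

Lemma ovr_updr x y : x ⊔ x.[y] = x.
Proof. by rewrite ovr_upd updA -upd_ovr ovrxx. Qed.

Lemma ovr_updl x y : x.[y] ⊔ x = x.[y].
Proof. by rewrite ovr_upd updK ovrxx. Qed.

Lemma ovr_updxy x y : y ⊔ x.[y] = y ⊔ x.
Proof. by rewrite ovr_upd updA ovrxx -ovr_upd. Qed.

Lemma upd_upd_id x y : x.[y.[x]] = x.
Proof. by rewrite -{1}(updxx x) updA -ovr_upd -upd_ovr. Qed.

(* For partial functions, [x ⊔ y = x] says that [dom y] is contained in [dom x]. *)
Definition eqdom x y := x ⊔ y = x /\ y ⊔ x = y.

Lemma eqdom_refl x : eqdom x x. Proof. by split; exact: ovrxx. Qed.

Lemma eqdom_upd x y : eqdom x x.[y].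
Proof. by split; [exact: ovr_updr|exact: ovr_updl]. Qed.

Lemma eqdom_upd_eq x y : eqdom x y -> x.[y] = y.
Proof.
move=> [xy yx].
by rewrite -[LHS](ovr_updl x y) -{2}xy ovrA ovr_updl -ovr_upd.
Qed.

Lemma eqdom_sym x y : eqdom x y -> eqdom y x.
Proof. by case. Qed.

Lemma eqdom_trans x y z : eqdom x y -> eqdom y z -> eqdom x z.
Proof.
move=> [xy yx] [yz zy]; split; first by rewrite -xy -ovrA yz.
by rewrite -zy -ovrA yx.
Qed.

Lemma ovr_absorb x y z : x ⊔ z = x -> x ⊔ y ⊔ z = x ⊔ y.
Proof. by move=> xz; rewrite -[in LHS]xz -(ovrA x) -ovrA ovrK ovrA xz. Qed.

Lemma upd_upd_eqdom a w x : eqdom a x -> a.[w].[x] = x.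
Proof.
move=> ax; apply: eqdom_upd_eq.
exact: eqdom_trans (eqdom_sym (eqdom_upd _ _)) ax.
Qed.

(* [a.[v.[x]]] depends on [v] only through its domain. *)
Lemma upd_eqdom a v w x : eqdom a x -> a.[v.[w].[x]] = a.[v.[x]].
Proof.
move=> ax; have [_ xa] := ax.
have exw : a.[x ⊔ w] = x by rewrite -updA upd_upd_eqdom.
by have := upd5 a v (x ⊔ w); rewrite exw !updA ovr_absorb.
Qed.

(** * Congruences: localization and maximality *)

Record congruence R : Prop := Congruence {
  cong_refl : forall x, R x x;
  cong_sym : forall x y, R x y -> R y x;
  cong_trans : forall y x z, R x y -> R y z -> R x z;
  cong_ovrl : forall z x y, R x y -> R (z ⊔ x) (z ⊔ y);
  cong_ovrr : forall z x y, R x y -> R (x ⊔ z) (y ⊔ z);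
  cong_updl : forall z x y, R x y -> R z.[x] z.[y];
  cong_updr : forall z x y, R x y -> R x.[z] y.[z] }.

(** Semantically, outside the domain of [u] the result of an operation depends only on its arguments
    there; [upd_u] and [upd_u'] express this for update. *)
Lemma congruence_localized R u :
  congruence R -> congruence (fun x y => R (u ⊔ x) (u ⊔ y)).
Proof.
move=> [Rr Rs Rt Rol Ror Rul Rur].
have upd_u z x : u ⊔ z.[x] = z.[u ⊔ x] ⊔ u by rewrite ovr_upd updA.
have upd_u' z x : u ⊔ x.[z] = u ⊔ (u ⊔ x).[z].
  by rewrite updDl ovrA ovr_updr.
split=> //.
- by move=> x y /Rs.
- by move=> y x z; exact: Rt.
- by move=> z x y /(Rol (u ⊔ z)); rewrite !ovrA !ovrK.
- by move=> z x y /(Ror z); rewrite !ovrA.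
- by move=> z x y /(Rul z)/(Ror u); rewrite !upd_u.
- by move=> z x y /(Rur z)/(Rol u); rewrite -!upd_u'.
Qed.

(* The congruence need not be reflexive for Zorn's lemma, so that the empty
   chain is harmless; maximality then restores reflexivity. *)
Lemma maximal_congruence a b : a <> b -> exists R,
  [/\ congruence R, ~ R a b &
      forall R', congruence R' -> (forall x y, R x y -> R' x y) ->
        ~ R' a b -> forall x y, R' x y -> R x y].
Proof.
move=> ab.
pose rc (X : set (A * A)) x y := x = y \/ X (x, y).
pose P (X : set (A * A)) := congruence (rc X) /\ ~ rc X a b.
have [F FP Ftot|X [[cX nX] maxX]] := @Zorn_bigcup _ P.
  have F1 x y : rc (\bigcup_(X in F) X)%classic x y ->
      x = y \/ exists2 X, F X & rc X x y.
    by move=> [->|[X FX Xxy]]; [left|right; exists X => //; right].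
  have F2 X x y : F X -> rc X x y -> rc (\bigcup_(X in F) X)%classic x y.
    by move=> FX [->|Xxy]; [left|right; exists X].
  have unary f : (forall X, F X -> forall x y, rc X x y -> rc X (f x) (f y)) ->
      forall x y, rc (\bigcup_(X in F) X)%classic x y ->
      rc (\bigcup_(X in F) X)%classic (f x) (f y).
    move=> Hf x y /F1[->|[X FX Xxy]]; first by left.
    by apply: (F2 X) => //; exact: Hf.
  split; last first.
    by move=> /F1[//|[X FX]]; case: (FP X FX).
  split; first by left.
  - move=> x y /F1[->|[X FX Xxy]]; first by left.
    by apply: (F2 X) => //; apply: cong_sym Xxy; case: (FP X FX).
  - move=> y x z /F1[->//|[X FX Xxy]] /F1[<-|[Z FZ Zyz]].
      exact: F2 Xxy.
    have [XZ|ZX] := Ftot _ _ FX FZ.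
      apply: (F2 Z) => //; apply: cong_trans Zyz; first by case: (FP Z FZ).
      by case: Xxy => [->|/XZ]; [left|right].
    apply: (F2 X) => //; apply: (cong_trans _ Xxy); first by case: (FP X FX).
    by case: Zyz => [->|/ZX]; [left|right].
  - by move=> z; apply: unary => X /FP[cX _]; exact: cong_ovrl.
  - move=> z; apply: (unary (fun x => x ⊔ z)) => X /FP[cX _].
    exact: cong_ovrr.
  - by move=> z; apply: unary => X /FP[cX _]; exact: cong_updl.
  - move=> z; apply: (unary (fun x => x.[z])) => X /FP[cX _].
    exact: cong_updr.
exists (rc X); split=> // R' cR' XR' nR' x y R'xy.
apply: contrapT => nXxy.
have rcR' : rc [set p | R' p.1 p.2]%classic = R'.
  apply/funext => u; apply/funext => v; apply/propext; split; last by right.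
  by move=> [->|//]; exact: cong_refl.
apply: (maxX [set p | R' p.1 p.2]%classic); last by split; rewrite rcR'.
split; first by move=> [u v] Xuv; apply: XR'; right.
by move=> /(_ (x, y) R'xy) Xxy; apply: nXxy; right.
Qed.

(** * Large domains, localizers and agreement *)

Section Separation.
Variables (R : A -> A -> Prop) (a b : A).
Hypotheses (cR : congruence R) (nRab : ~ R a b).
Hypothesis maxR : forall R', congruence R' ->
  (forall x y, R x y -> R' x y) -> ~ R' a b -> forall x y, R' x y -> R x y.

(* Semantically, the points outside [dom x] do not separate [a] from [b]. *)
Definition large x := R (x ⊔ a) (x ⊔ b).

(** The congruence localized at [i] contains [R] and does not relate [a] and [b], so maximality
    applies. *)
Lemma small_localized i x y : ~ large i -> R (i ⊔ x) (i ⊔ y) -> R x y.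
Proof.
move=> ni; apply: (maxR (congruence_localized i cR)) => // {}x {}y.
exact: cong_ovrl.
Qed.

Lemma large_ovr x y : large (x ⊔ y) <-> large x \/ large y.
Proof.
split=> [Lxy|[Lx|Ly]].
- have [|nx] := pselect (large x); [by left|right].
  by move: Lxy; rewrite /large -!ovrA => /(small_localized nx).
- by have := cong_ovrl cR (x ⊔ y) Lx; rewrite !ovrA ovrK.
- by have := cong_ovrl cR x Ly; rewrite !ovrA.
Qed.

Lemma large_eqdom x y : eqdom x y -> large x -> large y.
Proof. by move=> [_ <-] Lx; apply/large_ovr; right. Qed.

(* [a.[u.[x]]] is [x] on [dom u] and [a] elsewhere, if [eqdom a x]; so a
   localizer remembers only the values on finitely many large domains. *)
Inductive localizer : (A -> A) -> Prop :=
| loc_id : localizer id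
| loc_cons u f : large u -> localizer f -> localizer (fun x => a.[u.[f x]]).

Lemma loc1 u : large u -> localizer (fun x => a.[u.[x]]).
Proof. by move=> Lu; apply: (loc_cons Lu loc_id). Qed.

Lemma loc_comp f g : localizer f -> localizer g -> localizer (f \o g).
Proof. by move=> lf lg; elim: lf => // u h Lu _ IH; apply: loc_cons. Qed.

Lemma loc_cong f x y : localizer f -> R x y -> R (f x) (f y).
Proof.
by move=> lf Rxy; elim: lf => // u g _ _ IH; do 2 apply: (cong_updl cR).
Qed.

Lemma loc_eqdom f x : localizer f -> eqdom a x -> eqdom a (f x).
Proof. by move=> [//|u g _ _] _; exact: eqdom_upd. Qed.

(** The outer localization discards all values outside the domain of [u], so discarding them
    beforehand changes nothing. *)
Lemma loc_upd_absorb f u x : localizer f -> eqdom a x ->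
  a.[u.[f a.[u.[x]]]] = a.[u.[f x]].
Proof.
move=> lf ax; elim: lf => [|v g _ lg IH].
  by rewrite (upd5 u) upd_upd_eqdom.
have SuSvSu y : eqdom a y ->
    a.[u.[a.[v.[a.[u.[y]]]]]] = a.[u.[a.[v.[y]]]].
  move=> ay; have [_ ya] := ay.
  (* [upd6] turns the inner pass through [u] into an update of [v], which keeps the domain of [v]
     and so is dropped by [upd_eqdom]. *)
  by rewrite (upd5 a v) upd6 !updA (ovr_absorb _ ya) -updA upd_eqdom.
have ag := loc_eqdom lg.
rewrite -SuSvSu; last exact: ag (eqdom_upd _ _).
by rewrite IH SuSvSu //; exact: ag.
Qed.

Lemma loc_absorb f g x : localizer f -> localizer g -> eqdom a x ->
  f (g (f x)) = f (g x).
Proof.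
move=> lf lg ax; elim: lf g lg => // u f' Lu lf' IH g lg.
rewrite -(IH _ lg).
have := loc_upd_absorb u (loc_comp lf' lg) (loc_eqdom lf' ax).
by rewrite /= => ->; rewrite IH.
Qed.

(** Any [x] is recovered as [x.[u].[u.[x]]]: [x.[u]] holds its values outside the domain of [u], and
    [u.[x]] those inside. *)
Lemma localizer_inj_step u c d : eqdom a c -> eqdom a d ->
  R (u ⊔ c) (u ⊔ d) -> R a.[u.[c]] a.[u.[d]] -> R c d.
Proof.
move=> ac ad Rcd Rucd.
have uE x : eqdom a x -> u.[a.[u.[x]]] = u.[x].
  by move=> ax; rewrite (upd5 u) upd_upd_eqdom.
have := cong_updl cR u Rucd; rewrite !uE // => Rud.
have dc : d.[c] = c by apply: eqdom_upd_eq; exact: eqdom_trans (eqdom_sym ad) ac.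
have := cong_updl cR d Rcd; rewrite -!updA dc updxx => Rcu.
have eu x : x.[u].[u.[x]] = x by rewrite updA ovr_updl upd_upd_id.
rewrite -(eu c) -(eu d).
apply: (cong_trans cR (y := c.[u].[u.[d]])).
  exact: cong_updl.
exact: cong_updr.
Qed.

Lemma localizer_separates f : eqdom a b -> localizer f -> ~ R (f a) (f b).
Proof.
move=> ab; elim=> // u g Lu lg IH /localizer_inj_step H.
apply: IH; apply: H.
- exact: loc_eqdom (eqdom_refl a).
- exact: loc_eqdom ab.
(* Since [u] is large, the congruence localized at [u] relates [a] and [b]; the updates forming [g]
   preserve it. *)
- by elim: lg => //= v h _ _ IH; do 2 apply: (cong_updl (congruence_localized u cR)).
Qed.

(** Passing to [a.[x]] gives [x] the domain of [a], as the laws of localizers require. *)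
Definition agree x y := exists2 f, localizer f & R (f a.[x]) (f a.[y]).

Lemma agree_refl x : agree x x.
Proof. by exists id; [exact: loc_id|exact: cong_refl]. Qed.

Lemma agree_sym x y : agree x y -> agree y x.
Proof. by move=> [f lf Rf]; exists f => //; exact: cong_sym. Qed.

Lemma agree_trans x y z : agree x y -> agree y z -> agree x z.
Proof.
move=> [f lf Rf] [g lg Rg]; exists (g \o f); first exact: loc_comp.
apply: (cong_trans cR (y := g (f a.[y]))); first exact: loc_cong lg Rf.
(* Absorption turns [g \o f \o g] into [g \o f]. *)
have := loc_cong (loc_comp lg lf) Rg.
by rewrite /= !(loc_absorb lg lf) //; exact: eqdom_upd.
Qed.

Lemma agree_cong x y : R x y -> agree x y.
Proof. by move=> Rxy; exists id; [exact: loc_id|exact: cong_updl]. Qed.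

Lemma agree_ovr x y : large x -> agree (x ⊔ y) x.
Proof.
move=> Lx; apply: (ex_intro2 _ _ _ (loc1 Lx)).
rewrite !upd5 !updA -ovrA -!upd_ovr; exact: cong_refl.
Qed.

Lemma agree_upd x y : large x -> large y -> agree x.[y] y.
Proof.
(* [x.[y]] takes the values of [y] on the common domain of [x] and [y], hence one localization at
   each. *)
move=> Lx Ly; apply: (ex_intro2 _ _ _ (loc_comp (loc1 Ly) (loc1 Lx))).
rewrite /= (upd5 x a y) updA !(upd5 a x) !updA -ovrA -(updA x) -upd_ovr.
have := upd6 y a x (y ⊔ a); rewrite -upd_ovr updA ovrK => ->.
exact: cong_refl.
Qed.

Lemma agree_small_ovr i x : ~ large i -> agree (i ⊔ x) x.
Proof.
move=> ni; apply/agree_cong/(small_localized ni).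
by rewrite ovrA ovrxx; exact: cong_refl.
Qed.

Lemma agree_small_upd i x : ~ large i -> agree x.[i] x.
Proof.
move=> ni; apply/agree_cong/(small_localized ni).
by rewrite ovr_updxy; exact: cong_refl.
Qed.

End Separation.

(** * Points and the representation *)

Definition point (X : Type) (p : A -> option X) :=
  (forall x y, p (x ⊔ y) = if p x is Some s then Some s else p y) /\
  (forall x y, p x.[y] =
    if p x is Some s then Some (if p y is Some t then t else s) else None).

(** [D] prescribes where the point is defined, and the value at [x] is the class of [x] under
    [E]. *)
Lemma point_of (D : A -> Prop) (E : A -> A -> Prop) :
    (forall x y, D (x ⊔ y) <-> D x \/ D y) ->
    (forall x y, D x.[y] <-> D x) ->
    (forall x, E x x) -> (forall x y, E x y -> E y x) ->
    (forall x y z, E x y -> E y z -> E x z) ->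
    (forall x y, D x -> E (x ⊔ y) x) ->
    (forall i x, ~ D i -> E (i ⊔ x) x) ->
    (forall x y, D x -> D y -> E x.[y] y) ->
    (forall i x, ~ D i -> E x.[i] x) ->
  exists2 p : A -> option (set A), point p & forall x y, p x = p y ->
    (D x <-> D y) /\ (D x -> E x y).
Proof.
move=> Do Du Er Es Et Eo Eo' Eu Eu'.
have EE x y : E x y -> E x = E y.
  move=> xy; apply/funext => z; apply/propext.
  by split; apply: Et => //; exact: Es.
exists (fun x => if `[< D x >] then Some (E x) else None).
  split=> x y; case: asboolP => Dxy; case: (asboolP (D x)) => Dx //.
  - by rewrite (EE _ _ (Eo _ y Dx)).
  - case: asboolP => [Dy|]; last by move: Dxy => /Do[].
    by rewrite (EE _ _ (Eo' _ y Dx)).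
  - by case: Dxy; apply/Do; left.
  - by case: asboolP => // Dy; case: Dxy; apply/Do; right.
  - case: asboolP => Dy; first by rewrite (EE _ _ (Eu _ _ Dx Dy)).
    by rewrite (EE _ _ (Eu' _ x Dy)).
  - by case: Dx; apply/(Du x y).
  - by case: Dxy; apply/(Du x y).
move=> x y; case: asboolP => Dx; case: asboolP => Dy //= [].
by move=> Exy; split=> // _; rewrite Exy; exact: Er.
Qed.

Lemma points_separate_dom a b : b ⊔ a <> b ->
  exists2 p : A -> option (set A), point p & p a <> p b.
Proof.
(* The point is undefined exactly at elements whose domain lies in that of [b]; a single value
   suffices elsewhere. *)
move=> ba; pose D x := b ⊔ x <> b.
have Do x y : D (x ⊔ y) <-> D x \/ D y.
  split=> [H|].
    apply: contrapT => /not_orP[/contrapT bx /contrapT b_y].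
    by apply: H; rewrite ovrA bx.
  move=> + bxy; have bx : b ⊔ x = b by rewrite -[in LHS]bxy -ovrA ovrK.
  by case; apply=> //; rewrite -{1}bx -ovrA.
have Du x y : D x.[y] <-> D x.
  split=> H e; apply: H; first by rewrite -e -ovrA ovr_updr.
  by rewrite -e -ovrA ovr_updl.
have [|||||||p pp pE] := point_of (E := fun _ _ => True) Do Du; try by [].
exists p => // /pE[[+ _] _]; move=> /(_ ba); apply; exact: ovrxx.
Qed.

Lemma points_separate a b : a <> b ->
  exists2 p : A -> option (set A), point p & p a <> p b.
Proof.
move=> ab; have [ba|ba] := pselect (b ⊔ a = b); last exact: points_separate_dom.
have [ab'|ab'] := pselect (a ⊔ b = a); last first.
  by have [p pp pba] := points_separate_dom ab'; exists p => // /esym.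
have [R [cR nRab maxR]] := maximal_congruence ab.
have ab1 : eqdom a b by [].
have [|||||||||p pp pE] := @point_of (large R a b) (agree R a b).
- exact: large_ovr.
- move=> x y; have e := eqdom_upd x y.
  by split; apply: large_eqdom => //; exact: eqdom_sym.
- exact: agree_refl.
- exact: agree_sym.
- exact: agree_trans.
- exact: agree_ovr.
- exact: agree_small_ovr.
- exact: agree_upd.
- exact: agree_small_upd.
exists p => // /pE[_].
(* As [a ⊔ b = a], largeness of [a] is reflexivity of [R]; equal values would then give
   [agree a b]. *)
have La : large R a b a by rewrite /large ovrxx ab'; exact: cong_refl.
move=> /(_ La)[f lf].
rewrite updxx (eqdom_upd_eq ab1); exact: (localizer_separates cR nRab ab1 lf).
Qed.

Lemma representable : ou_Rep A.
Proof.
pose X := {p : A -> option (set A) | point p}.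
pose h a : pfun_ou X (set A) := fun p => sval p a.
have hm : ou_morphism h.
  split=> x y; apply/funext => -[p [po pu]]; rewrite /= /h /=.
    by rewrite po.
  by rewrite pupdateE pu.
exists X, (set A), (range h)%classic, h; split=> //.
- have p0 : point (fun _ : A => None : option (set A)) by [].
  exact: inhabits (exist _ _ p0).
- exact: inhabits set0.
- move=> _ _ [x _ <-] [y _ <-]; split.
    by exists (x ⊔ y) => //; rewrite hm.1.
  by exists x.[y] => //; rewrite hm.2.
- apply: inj_bij => x y _ _ hxy; apply: contrapT => /points_separate[p pp].
  by apply; exact: (congr1 (fun k => k (exist _ p pp)) hxy).
Qed.

End Theory.

Theorem theorem5p1 (A : ouAlgebra) :
  ou_Rep A <->
  (forall x y z : A, x ⊔ (y ⊔ z) = (x ⊔ y) ⊔ z) /\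
  (forall x : A, x ⊔ x = x) /\
  (forall x y : A, x = x.[x ⊔ y]) /\
  (forall x y : A, x ⊔ y = y.[x] ⊔ x) /\
  (forall x y z : A, x.[y].[z] = x.[z ⊔ y]) /\
  (forall x y z : A, (x ⊔ y).[z] = x.[z] ⊔ y.[z]) /\
  (forall x y z : A, x.[y.[x.[z]]] = x.[y.[x].[z]]) /\
  (forall w x y z : A, w.[x.[y.[w.[z]]]] = w.[x.[y.[w].[z]]]).
Proof.
split=> [[X [Y [S [h [_ _ _ [_ inj _] [ho hu]]]]]]|
         [? [? [? [? [? [? [? ?]]]]]]]]; last exact: representable.
have hI x y : h x =1 h y -> x = y.
  by move=> /funext hxy; apply: inj; rewrite ?in_setT.
repeat split=> *; apply: hI => p; rewrite !(ho, hu) /= /poverride ?pupdateE.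
all: by do ?[case: (h _ p) => [?|] //=].
Qed.
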